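(* Let $K\subset\mathbb R$ be compact. There exist smooth functions $\chi_\varepsilon:[0,\infty)\to\mathbb R$ ($\varepsilon>0$) such that $\chi_\varepsilon(r)=0$ for $r\le\varepsilon$, $\chi_\varepsilon(r)=1$ for $r\ge2\varepsilon$, and, as $\varepsilon\downarrow0$, $$\int_K\int_0^\infty|\partial_r\chi_\varepsilon|^2r^3\,dr\,dz\longrightarrow0,\qquad \int_K\int_0^\infty|1-\chi_\varepsilon|^2r^3\,dr\,dz\longrightarrow0.$$ In particular, the set $\{r=0\}\times K$ has zero $H^1(d\mu_5)$ capacity.
   Context: Here $(r,z)\in[0,\infty)\times\mathbb R$ and $d\mu_5=r^3\,dr\,dz$. The $H^1(d\mu_5)$ capacity of a compact set $A$ is the infimum of $\int(|v|^2+|\partial_rv|^2+|\partial_zv|^2)\,d\mu_5$ over functions $v$ of finite norm that are equal to $1$ in a neighbourhood of $A$ in $[0,\infty)\times\mathbb R$. Up to a constant factor this is the $H^1(\mathbb R^5)$ capacity restricted to functions of $(y,z)\in\mathbb R^4\times\mathbb R$ radial in $y$, with $r=|y|$. *)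

(* Defs.v *)
From HB Require Import structures.
From mathcomp Require Import all_boot all_order all_algebra.
From mathcomp Require Import all_classical all_reals all_analysis.

Set Implicit Arguments.
Unset Strict Implicit.
Unset Printing Implicit Defensive.

Import Order.TTheory GRing.Theory Num.Theory.
Import numFieldNormedType.Exports.

Local Open Scope ring_scope.
Local Open Scope classical_set_scope.

(* A function on [0, +oo[ is represented by a total function on R whose values
   at negative arguments are irrelevant; it is smooth up to the boundary point 0
   when it is the restriction of a smooth function on R. *)
Definition smooth (R : realType) (f : R -> R) : Prop :=
  forall n (x : R), derivable (f^`(n)) x 1.

Definition smooth_half_line (R : realType) (f : R -> R) : Prop :=
  exists2 g : R -> R, smooth g & forall r, 0 <= r -> f r = g r.

(* In the plane, points are pairs p = (r, z). *)
Definition closed_half_plane (R : realType) : set (R * R) :=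
  [set p | 0 <= p.1].

Definition open_half_plane (R : realType) : set (R * R) :=
  [set p | 0 < p.1].

Arguments closed_half_plane R : clear implicits.
Arguments open_half_plane R : clear implicits.

Definition e_r (R : realType) : R * R := (1, 0).

Definition e_z (R : realType) : R * R := (0, 1).

Definition iter_partial (R : realType) (s : seq bool) (f : R * R -> R) :
    R * R -> R :=
  foldr (fun (b : bool) (g : R * R -> R) (p : R * R) =>
           'D_(if b then e_r R else e_z R) g p) f s.

(* C^oo: all iterated partial derivatives, in any order, exist and are
   continuous. *)
Definition smooth_plane (R : realType) (f : R * R -> R) : Prop :=
  forall s : seq bool,
    [/\ continuous (iter_partial s f),
        forall p, derivable (iter_partial s f) p (e_r R)
      & forall p, derivable (iter_partial s f) p (e_z R)].

(* phi \in C_c^oo(]0, +oo[ x R) *)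
Definition test_function (R : realType) (phi : R * R -> R) : Prop :=
  let supp := closure [set p | phi p != 0] in
  [/\ smooth_plane phi, compact supp & supp `<=` open_half_plane R].

Definition drdz (R : realType) :=
  ((@lebesgue_measure R) \x (@lebesgue_measure R))%E.

(* g is the distributional derivative of v in the direction e on ]0, +oo[ x R.
   The line r = 0 needs no test functions: it corresponds to {0} x R in R^5,
   which has codimension 4 and is removable for H^1. *)
Definition weak_derivative (R : realType) (e : R * R) (v g : R * R -> R) :
    Prop :=
  forall phi : R * R -> R, test_function phi ->
    (\int[@drdz R]_(p in open_half_plane R) (v p * 'D_e phi p)%:E =
     - \int[@drdz R]_(p in open_half_plane R) (g p * phi p)%:E)%E.

(* Integral of f over [0, +oo[ x R against d mu_5 = r^3 dr dz. *)
Definition integral_mu5 (R : realType) (f : R * R -> R) : \bar R :=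
  (\int[@drdz R]_(p in closed_half_plane R) (f p * p.1 ^+ 3)%:E)%E.

Definition sq_norm_H1_mu5 (R : realType) (v vr vz : R * R -> R) : \bar R :=
  integral_mu5 (fun p => `|v p| ^+ 2 + `|vr p| ^+ 2 + `|vz p| ^+ 2).

(* v belongs to H^1(d mu_5), with weak derivatives vr and vz (which are unique
   up to a null set). *)
Definition in_H1_mu5 (R : realType) (v vr vz : R * R -> R) : Prop :=
  [/\ [/\ measurable_fun (closed_half_plane R) v,
          measurable_fun (closed_half_plane R) vr
        & measurable_fun (closed_half_plane R) vz],
      weak_derivative (e_r R) v vr,
      weak_derivative (e_z R) v vz
    & (sq_norm_H1_mu5 v vr vz < +oo)%E].

Definition eq1_near (R : realType) (A : set (R * R)) (v : R * R -> R) : Prop :=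
  exists U : set (R * R),
    [/\ open U, A `<=` U
      & forall p, (U `&` closed_half_plane R) p -> v p = 1].

Definition capacity_mu5 (R : realType) (A : set (R * R)) : \bar R :=
  ereal_inf [set E : \bar R | exists v vr vz : R * R -> R,
    [/\ in_H1_mu5 v vr vz, eq1_near A v & E = sq_norm_H1_mu5 v vr vz]].

(* Main.v *)
Require Import Defs.
From HB Require Import structures.
From mathcomp Require Import all_boot all_order all_algebra.
From mathcomp Require Import all_classical all_reals all_analysis.
From mathcomp Require Import measurable_realfun ring lra.

Import Order.TTheory GRing.Theory Num.Theory.
Import numFieldNormedType.Exports.

Local Open Scope ring_scope.
Local Open Scope classical_set_scope.

Set Implicit Arguments.
Unset Strict Implicit.
Unset Printing Implicit Defensive.

(* The weight r^3 makes a tube of radius 2 eps around r = 0 of mass O(eps^4),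
   whereas the rescaled cutoff chi_eps(r) = step(r/eps - 1) has slope O(1/eps):
   its energy is O(eps^2). For the capacity, (1 - chi_eps(r)) b(z) with a fixed
   cutoff b equal to 1 near K is a competitor of norm O(eps^2); it is smooth, so
   its weak derivatives are the classical ones by Fubini and the fundamental
   theorem of calculus on lines. *)

(** * A smooth transition built from exp(-1/x) *)

Definition flat (R : realType) (n : nat) (x : R) : R :=
  if 0 < x then x^-1 ^+ n * expR (- x^-1) else 0.

Lemma flat_pos (R : realType) n (x : R) : 0 < x ->
  flat n x = x^-1 ^+ n * expR (- x^-1).
Proof. by rewrite /flat => ->. Qed.

Lemma flat_npos (R : realType) n (x : R) : x <= 0 -> flat n x = 0.
Proof. by rewrite /flat ltNge => ->. Qed.

Lemma flat_ge0 (R : realType) n (x : R) : 0 <= flat n x.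
Proof.
rewrite /flat; case: ifPn => // x0.
by rewrite mulr_ge0 ?expR_ge0// exprn_ge0// invr_ge0 ltW.
Qed.

(** The series of exp(1/x) dominates its term of degree n+2. Of the powers of x that this term
    supplies, n cancel x^-n and two remain; they make the derivative at 0 vanish. *)
Lemma flat_le_sqr (R : realType) n (x : R) :
  flat n x <= (n.+2)`!%:R * x ^+ 2.
Proof.
have [x0|x0] := leP x 0; first by rewrite flat_npos// mulr_ge0// sqr_ge0.
rewrite flat_pos// expRN ler_pdivrMr ?expR_gt0//.
have xV0 : 0 <= x^-1 by rewrite invr_ge0 ltW.
have F0 : 0 < (n.+2)`!%:R :> R by rewrite ltr0n fact_gt0.
have le_exp : x^-1 ^+ n.+2 / (n.+2)`!%:R <= expR x^-1.
  by rewrite (le_trans _ (expR_ge1Dxn n.+1 xV0))// lerDr.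
apply: le_trans (ler_wpM2l _ le_exp); last by rewrite mulr_ge0 ?sqr_ge0// ltW.
rewrite [leRHS](_ : _ = x^-1 ^+ n)// -addn2 exprD.
by move: (x^-1 ^+ n) => u; field; rewrite ?gt_eqF// addn2.
Qed.

(** The bound forces f(0) = 0, and then the difference quotient at 0 is at most |C| |h|. *)
Lemma is_derive_quadratic_bound (R : realType) (f : R -> R) (C : R) :
  (forall x, `|f x| <= C * x ^+ 2) -> is_derive (0 : R) (1 : R) f 0.
Proof.
move=> fC.
have f00 : f 0 = 0.
  by apply/eqP; rewrite -normr_le0 (le_trans (fC 0))// expr0n mulr0.
have cvg0 : h^-1 *: ((f \o shift 0) (h *: (1 : R)) - f 0) @[h --> 0^']
    --> (0 : R).
  apply/cvgr0Pnorm_lt => e e0.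
  (* The smallness condition on [h] divides by this constant, so it has to be strictly positive. *)
  have C0 : 0 < `|C| + 1 by rewrite ltr_wpDl.
  near=> h.
  have h0 : h != 0 by near: h; exact: nbhs_dnbhs_neq.
  rewrite /= f00 subr0 addr0 /GRing.scale/= mulr1 normrM normfV.
  rewrite mulrC ltr_pdivrMr ?normr_gt0//.
  apply: le_lt_trans (fC h) _; rewrite -real_normK ?num_real// expr2 mulrA.
  rewrite ltr_pM2r ?normr_gt0//.
  apply: (@le_lt_trans _ _ ((`|C| + 1) * `|h|)).
    by rewrite ler_wpM2r// (le_trans (ler_norm C))// lerDl.
  rewrite -ltr_pdivlMl//; near: h; apply: dnbhs0_lt.
  by rewrite mulr_gt0// invr_gt0.
apply: DeriveDef; first by apply/cvg_ex; exists 0.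
exact/cvg_lim.
Unshelve. all: by end_near. Qed.

(** For x > 0 this is the product rule: the exponential contributes x^-(n+2) and the power
    contributes -n x^-(n+1). At the junction 0 the quadratic bound applies. *)
Lemma is_derive_flat (R : realType) n (x : R) :
  is_derive x 1 (flat n) (flat n.+2 x - n%:R * flat n.+1 x).
Proof.
have [x0|x0|->] := ltgtP x 0.
- rewrite !flat_npos ?ltW// mulr0 subr0.
  apply: (@near_eq_is_derive _ _ _ (cst 0)) => //.
  by apply: filterS (lt_nbhsl x0) => y y0; rewrite flat_npos ?ltW.
- rewrite !flat_pos//.
  apply: (@near_eq_is_derive _ _ _ (fun y : R => y^-1 ^+ n * expR (- y^-1))).
    by apply: filterS (lt_nbhsr x0) => y y0; rewrite flat_pos.
  have dV : is_derive x 1 (fun y : R => y^-1) (- x ^- 2 *: 1).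
    by apply: is_deriveV; rewrite gt_eqF.
  have dE : is_derive x 1 (fun y : R => expR (- y^-1))
      (expR (- x^-1) * - (- x ^- 2 *: 1)).
    exact: (@is_derive1_comp _ expR (fun y => - y^-1)).
  have dX : is_derive x 1 (fun y : R => y^-1 ^+ n)
      ((n%:R * x^-1 ^+ n.-1) *: (- x ^- 2 *: 1)).
    by have := is_deriveX n dV; rewrite exprfctE.
  apply: (is_derive_eq (is_deriveM dX dE)).
  (* The exponent [n.-1] of the power rule is truncated at n = 0, where the coefficient n removes
     the term; hence the case split. *)
  rewrite -!exprVn /GRing.scale /= !mulr1; move: {dX} n => [|n] /=.
    by rewrite mul0r expr0; ring.
  by rewrite !exprS; ring.
- rewrite !flat_npos// mulr0 subr0.
  apply: (@is_derive_quadratic_bound _ _ (n.+2)`!%:R) => y.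
  by rewrite ger0_norm ?flat_ge0// flat_le_sqr.
Qed.

(* This class contains the derivatives of its members, whence their smoothness;
   the powers x^-n in [flat] are there for that closure. *)
Inductive smooth_expr (R : realType) : (R -> R) -> Prop :=
| smooth_cst c : smooth_expr (cst c)
| smooth_id : smooth_expr id
| smooth_flat n : smooth_expr (flat n)
| smooth_add f g : smooth_expr f -> smooth_expr g ->
    smooth_expr (fun x => f x + g x)
| smooth_mul f g : smooth_expr f -> smooth_expr g ->
    smooth_expr (fun x => f x * g x)
| smooth_inv f : smooth_expr f -> (forall x, f x != 0) ->
    smooth_expr (fun x => (f x)^-1)
| smooth_comp f g : smooth_expr f -> smooth_expr g -> smooth_expr (f \o g).

Lemma smooth_expr_derive (R : realType) (f : R -> R) : smooth_expr f ->
  exists2 f' : R -> R, smooth_expr f' & forall x : R, is_derive x 1 f (f' x).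
Proof.
elim=> {f} [c||n|f g sf [f' sf' df] sg [g' sg' dg]
  |f g sf [f' sf' df] sg [g' sg' dg]|f sf [f' sf' df] f0
  |f g sf [f' sf' df] sg [g' sg' dg]].
- by exists (cst 0); [exact: smooth_cst|move=> x; exact: is_derive_cst].
- by exists (cst 1); [exact: smooth_cst|move=> x; exact: is_derive_id].
- exists (fun x => flat n.+2 x + cst (- n%:R) x * flat n.+1 x).
    by do ![apply: smooth_add|apply: smooth_mul|apply: smooth_cst
      |apply: smooth_flat].
  by move=> x; rewrite /cst/= mulNr; exact: is_derive_flat.
- exists (fun x => f' x + g' x); first exact: smooth_add.
  by move=> x; exact: is_deriveD.
- exists (fun x => f x * g' x + g x * f' x).
    by apply: smooth_add; apply: smooth_mul.
  by move=> x; apply: is_deriveM.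
- exists (fun x => (cst (-1) x * ((f x)^-1 * (f x)^-1)) * f' x).
    by do !(apply: smooth_mul => //; try exact: smooth_cst); exact: smooth_inv.
  move=> x; apply: (is_derive_eq (is_deriveV (f0 x) (df x))).
  by rewrite /GRing.scale/= mulN1r -exprVn expr2.
- exists (fun x => (f' \o g) x * g' x).
    by apply: smooth_mul => //; exact: smooth_comp.
  by move=> x; apply: is_derive1_comp.
Qed.

(** Differentiation maps the class into itself, so every iterated derivative is again a derivable
    member. *)
Lemma smooth_expr_smooth (R : realType) (f : R -> R) : smooth_expr f ->
  smooth f.
Proof.
move=> sf n; suff: smooth_expr (f^`(n)).
  by move=> /smooth_expr_derive[f' _ df] x; case: (df x).
elim: n => [//|n /smooth_expr_derive[f' sf' df]].
rewrite derive1nS; rewrite (_ : _^`() = f')//.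
by apply/funext => x; rewrite derive1E derive_val.
Qed.

Lemma smooth_expr_continuous (R : realType) (f : R -> R) : smooth_expr f ->
  continuous f.
Proof.
move=> /smooth_expr_derive[f' _ df] x.
by apply/differentiable_continuous/derivable1_diffP; case: (df x).
Qed.

(** The standard smooth transition, equal to 0 for x <= 0 and to 1 for x >= 1. *)
Definition step (R : realType) (x : R) : R :=
  flat 0 x / (flat 0 x + flat 0 (1 - x)).

(** x and 1 - x are never both nonpositive, so one of the two summands is positive. *)
Lemma step_den_gt0 (R : realType) (x : R) : 0 < flat 0 x + flat 0 (1 - x).
Proof.
have [x0|x0] := ltP 0 x.
  by rewrite ltr_pwDl ?flat_ge0// flat_pos// expr0 mul1r expR_gt0.
have x1 : 0 < 1 - x by lra.
by rewrite ltr_wpDl ?flat_ge0// flat_pos// expr0 mul1r expR_gt0.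
Qed.

Lemma smooth_expr_step (R : realType) : smooth_expr (@step R).
Proof.
rewrite /step; apply: smooth_mul; first exact: smooth_flat.
apply: smooth_inv => [|x]; last by rewrite gt_eqF// step_den_gt0.
apply: smooth_add; first exact: smooth_flat.
apply: (@smooth_comp _ (flat 0) (fun x => 1 - x)); first exact: smooth_flat.
rewrite (_ : (fun _ => _) = (fun x : R => cst 1 x + cst (-1) x * id x)).
  apply: smooth_add; first exact: smooth_cst.
  by apply: smooth_mul; [exact: smooth_cst|exact: smooth_id].
by apply/funext => x; rewrite /= mulN1r.
Qed.

Lemma step_le0 (R : realType) (x : R) : x <= 0 -> step x = 0.
Proof. by move=> x0; rewrite /step flat_npos// mul0r. Qed.

Lemma step_ge1 (R : realType) (x : R) : 1 <= x -> step x = 1.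
Proof.
move=> x1; rewrite /step (@flat_npos _ _ (1 - x)) ?subr_le0// addr0 divff//.
have := step_den_gt0 x; rewrite (@flat_npos _ _ (1 - x)) ?subr_le0// addr0.
by move/gt_eqF->.
Qed.

Lemma step_ge0 (R : realType) (x : R) : 0 <= step x.
Proof. by rewrite divr_ge0 ?flat_ge0// ltW// step_den_gt0. Qed.

Lemma step_le1 (R : realType) (x : R) : step x <= 1.
Proof.
by rewrite ler_pdivrMr ?step_den_gt0// mul1r lerDl flat_ge0.
Qed.

(** * Measurability and integrability in the plane *)

Lemma drdz_setX (R : realType) (A B : set R) : measurable A -> measurable B ->
  @drdz R (A `*` B) = (@lebesgue_measure R A * @lebesgue_measure R B)%E.
Proof. by move=> mA mB; exact: product_measure1E. Qed.

(** An open set is the union of the countably many open boxes with rational endpoints that it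
    contains, and boxes are measurable for the product sigma-algebra. *)
Lemma open_measurable_prod (R : realType) (O : set (R * R)) :
  open O -> measurable O.
Proof.
move=> oO.
pose box (q : rat * rat * (rat * rat)) : set (R * R) :=
  `]ratr q.1.1, ratr q.1.2[%classic `*` `]ratr q.2.1, ratr q.2.2[%classic.
rewrite (_ : O = \bigcup_q (if `[< box q `<=` O >] then box q else set0)).
  apply: countable_bigcupT_measurable; first exact: countableP.
  by move=> q; case: ifP => // _; exact: measurableX.
apply/seteqP; split=> [[x y] Oxy|p [q _]]; last first.
  by case: ifP => // /asboolP; exact.
have /nbhs_ballP[e /= e0 eO] : nbhs (x, y) O by exact: open_nbhs_nbhs.
(* Balls of the product are squares: rational endpoints within [e] on both sides of each coordinate
   keep the box inside [O]. *)
have btw z : z - e < z /\ z < z + e by lra.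
have [q1 q1P] := rat_in_itvoo (btw x).1.
have [q2 q2P] := rat_in_itvoo (btw x).2.
have [q3 q3P] := rat_in_itvoo (btw y).1.
have [q4 q4P] := rat_in_itvoo (btw y).2.
move: q1P q2P q3P q4P; rewrite !in_itv/= => q1P q2P q3P q4P.
exists ((q1, q2), (q3, q4)) => //; rewrite asboolT.
  by rewrite /box /= !in_itv/=; lra.
move=> [u w]; rewrite /box /= !in_itv/= => uw; apply: eO.
by split; rewrite /ball/= ltr_norml; lra.
Qed.

Lemma continuous_measurable_prod (R : realType) (h : R * R -> R) :
  continuous h -> measurable_fun setT h.
Proof.
move=> ch; apply: (measurability _ (RGenOInfty.measurableE R)).
move=> /= _ [_ [a ->]] <-; apply: measurableI => //.
by apply: open_measurable_prod; apply: open_comp => // x _; exact: ch.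
Qed.

(** Phrased through nonzero values, the condition passes at once to products and to slices. *)
Definition vanishes_outside (R : realType) (N : R) (h : R * R -> R) :=
  forall p, h p != 0 -> - N < p.1 < N /\ - N < p.2 < N.

Lemma vanishes_outside_integrable (R : realType) (N : R) (h : R * R -> R) :
  continuous h -> vanishes_outside N h ->
  (@drdz R).-integrable setT (EFin \o h).
Proof.
move=> ch hN.
set B : set (R * R) := `[- N, N] `*` `[- N, N].
have hB : h \_ B = h.
  apply/funext => p; rewrite patchE; case: ifPn => // /negP pB.
  apply/esym/eqP/negPn/negP => /hN[p1 p2]; apply: pB.
  by rewrite inE /B/= !in_itv/=; lra.
have mB : measurable B by exact: measurableX.
have Bfin : (@drdz R B < +oo)%E.
  rewrite drdz_setX//= lebesgue_measure_itv/=.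
  by case: ifP => _; rewrite ?mul0e// -EFinB -EFinM ltry.
have : (@drdz R).-integrable B (EFin \o h).
  apply: measurable_bounded_integrable => //.
  - exact: measurable_funS (continuous_measurable_prod ch).
  - have cB : compact (h @` B).
      apply: continuous_compact; first exact: continuous_subspaceT.
      by apply: compact_setX; exact: segment_compact.
    have [M [Mr hM]] := compact_bounded cB.
    by exists M; split => // x Mx p Bp /=; apply: hM => //; exists p.
set mu := (@lebesgue_measure R \x @lebesgue_measure R)%E.
move=> iB; have := (integrable_mkcond (mu := mu) (EFin \o h) mB).1 iB.
by rewrite restrict_EFin hB.
Qed.

(** * Integration by parts: classical derivatives are weak derivatives *)

Lemma integral_derivative_eq0 (R : realType) (N : R) (F f : R -> R) :
  (forall x : R, is_derive x 1 F (f x)) -> continuous f ->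
  (forall x, F x != 0 -> - N < x < N) -> (forall x, f x != 0 -> - N < x < N) ->
  (\int[@lebesgue_measure R]_x (f x)%:E = 0)%E.
Proof.
move=> dF cf FN fN.
(* With this choice -M < M whatever the sign of [N], and [F] vanishes at both endpoints. *)
pose M : R := `|N| + 1.
have NM : `|N| < M by rewrite /M ltrDl.
have leN := ler_norm N.
have M0 : 0 < M by apply: le_lt_trans NM.
have cF : continuous F.
  by move=> x; apply/differentiable_continuous/derivable1_diffP; case: (dF x).
have F0 x : M <= `|x| -> F x = 0.
  move=> Mx; apply/eqP/negPn/negP => /FN; rewrite -ltr_norml.
  by move: leN NM Mx; lra.
have -> : (\int[@lebesgue_measure R]_x (f x)%:E =
    \int[@lebesgue_measure R]_(x in `[(- M)%R, M]) (f x)%:E)%E.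
  rewrite [RHS]integral_mkcond; apply: eq_integral => x _.
  rewrite patchE; case: ifPn => // /negP xM; congr (_%:E).
  apply/eqP/negPn/negP => /fN xN; apply: xM.
  by rewrite inE/= in_itv/=; move: leN NM xN; lra.
rewrite (@continuous_FTC2 _ f F); first last.
- by move=> x _; rewrite derive1E derive_val.
- split; first by move=> x _; case: (dF x).
  + exact/cvg_at_right_filter/cF.
  + exact/cvg_at_left_filter/cF.
- exact: continuous_subspaceT.
- by move: M0; lra.
by rewrite !F0 ?subee// ?normrN ler_norm.
Qed.

Lemma continuous_slices (R : realType) (h : R * R -> R) : continuous h ->
  (forall z, continuous (fun r => h (r, z))) /\
  (forall r, continuous (fun z => h (r, z))).
Proof.
move=> ch; split=> [z r|r z].
  apply: (@continuous_comp _ _ _ (fun x => (x, z)) h); last exact: ch.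
  exact: (cvg_pair cvg_id (cvg_cst _)).
apply: (@continuous_comp _ _ _ (fun x => (r, x)) h); last exact: ch.
exact: (cvg_pair (cvg_cst _) cvg_id).
Qed.

(** Along a coordinate vector, the difference quotient in the plane is literally that of the slice,
    so the library's one-variable calculus applies. *)
Lemma is_derive_slice_r (R : realType) (h : R * R -> R) (r z d : R) :
  is_derive ((r, z) : R * R) (e_r R) h d <->
  is_derive r (1 : R) (fun x => h (x, z)) d.
Proof.
have E : (fun t : R => t^-1 *: ((h \o shift (r, z)) (t *: e_r R) - h (r, z))) =
    (fun t : R =>
       t^-1 *: (((fun x => h (x, z)) \o shift r) (t *: (1 : R)) - h (r, z))).
  apply/funext => t; congr (_ *: (h _ - _)).
  by congr pair; rewrite /= ?scaler0 ?add0r.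
split=> -[D <-]; apply: DeriveDef.
- by move: D; rewrite /derivable E.
- by rewrite /derive E.
- by move: D; rewrite /derivable E.
- by rewrite /derive E.
Qed.

Lemma is_derive_slice_z (R : realType) (h : R * R -> R) (r z d : R) :
  is_derive ((r, z) : R * R) (e_z R) h d <->
  is_derive z (1 : R) (fun x => h (r, x)) d.
Proof.
have E : (fun t : R => t^-1 *: ((h \o shift (r, z)) (t *: e_z R) - h (r, z))) =
    (fun t : R =>
       t^-1 *: (((fun x => h (r, x)) \o shift z) (t *: (1 : R)) - h (r, z))).
  apply/funext => t; congr (_ *: (h _ - _)).
  by congr pair; rewrite /= ?scaler0 ?add0r.
split=> -[D <-]; apply: DeriveDef.
- by move: D; rewrite /derivable E.
- by rewrite /derive E.
- by move: D; rewrite /derivable E.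
- by rewrite /derive E.
Qed.

(** The Boolean coding of directions is that of [iter_partial], so that both partial derivatives
    share their proofs. *)
Definition axis (R : realType) (b : bool) : R * R :=
  if b then e_r R else e_z R.

(** By Fubini the inner integral can be taken along the direction of differentiation, where it
    vanishes on every line. *)
Lemma integral_partial_eq0 (R : realType) (N : R) (b : bool)
    (psi H : R * R -> R) :
  (forall p, is_derive p (axis R b) psi (H p)) -> continuous H ->
  vanishes_outside N psi -> vanishes_outside N H ->
  (\int[@drdz R]_p (H p)%:E = 0)%E.
Proof.
move=> dpsi cH psiN HN.
have iH := vanishes_outside_integrable cH HN.
case: b dpsi => dpsi.
  rewrite /drdz -(integral21_prod_meas1 iH).
  apply: integral0_eq => z _.
  apply: (@integral_derivative_eq0 _ N (fun x => psi (x, z))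
    (fun x => H (x, z))).
  - by move=> x; apply/is_derive_slice_r; exact: dpsi.
  - exact: (continuous_slices cH).1.
  - by move=> x /psiN[].
  - by move=> x /HN[].
rewrite /drdz -(integral12_prod_meas1 iH).
apply: integral0_eq => r _.
apply: (@integral_derivative_eq0 _ N (fun x => psi (r, x)) (fun x => H (r, x))).
- by move=> x; apply/is_derive_slice_z; exact: dpsi.
- exact: (continuous_slices cH).2.
- by move=> x /psiN[].
- by move=> x /HN[].
Qed.

(** Off the closed support the function is zero in a neighbourhood, hence so is its derivative
    there. *)
Lemma derive_neq0_support (R : realType) (phi : R * R -> R) (e p : R * R) :
  'D_e phi p != 0 -> closure [set q | phi q != 0] p.
Proof.
apply: contraNP => np; apply/eqP.
have oC : open (~` closure [set q | phi q != 0]).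
  by apply: closed_openC; exact: closed_closure.
have near0 : \near p, phi p = cst 0 p.
  apply: filterS (open_nbhs_nbhs (conj oC np)) => q nq.
  by apply/eqP/negPn/negP => phiq; apply: nq; exact: subset_closure.
by rewrite (near_eq_derive _ near0) derive_cst.
Qed.

(** A single [N] serves every function supported in [S]: it is used for a test function and for its
    derivative. *)
Lemma compact_vanishes_outside (R : realType) (S : set (R * R)) : compact S ->
  exists N : R, forall h : R * R -> R, (forall p, h p != 0 -> S p) ->
    vanishes_outside N h.
Proof.
(* Boundedness yields a norm of at most |M| + 1; one more unit makes the inequalities strict. *)
move=> /compact_bounded[M [_ SM]]; exists (`|M| + 2) => h hS p /hS Sp.
have /SM/(_ _ Sp) /= : M < `|M| + 1.
  by rewrite (le_lt_trans (ler_norm M))// ltrDl.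
rewrite prod_normE/= ge_max => /andP[p1 p2].
by rewrite -!ltr_norml; split; [move: p1|move: p2]; lra.
Qed.

(** The derivative of v phi is v D phi + g phi, and its integral is zero because v phi has bounded
    support. *)
Lemma weak_derivative_C1 (R : realType) (b : bool) (v g : R * R -> R) :
  continuous v -> continuous g -> (forall p, is_derive p (axis R b) v (g p)) ->
  weak_derivative (axis R b) v g.
Proof.
move=> cv cg dv phi [sphi cS Spos].
set D := 'D_(axis R b) phi.
have [N NP] := compact_vanishes_outside cS.
have phiS p : phi p != 0 -> closure [set q | phi q != 0] p.
  by move=> ?; exact: subset_closure.
have DS p : D p != 0 -> closure [set q | phi q != 0] p.
  exact: derive_neq0_support.
have cphi : continuous phi by case: (sphi [::]).
have cD : continuous D by have [cD _ _] := sphi [:: b]; exact: cD.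
have dphi p : is_derive p (axis R b) phi (D p).
  by apply: derivableP; case: (sphi [::]) => _ ? ?; case: b @D dv DS cD.
have vN h k : vanishes_outside N h -> vanishes_outside N (fun p => k p * h p).
  by move=> hN p; rewrite mulf_eq0 negb_or => /andP[_ /hN].
have phiN := NP _ phiS; have DN := NP _ DS.
have cM (h k : R * R -> R) : continuous h -> continuous k ->
    continuous (fun p => h p * k p).
  by move=> ch ck p; apply: cvgM; [exact: ch|exact: ck].
(* The support of phi lies in the open half-plane, so both integrals extend to the whole plane. *)
have ext h k : (forall p, h p != 0 -> closure [set q | phi q != 0] p) ->
    (\int[@drdz R]_(p in open_half_plane R) (k p * h p)%:E =
     \int[@drdz R]_p (k p * h p)%:E)%E.
  move=> hS; rewrite integral_mkcond; apply: eq_integral => p _.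
  rewrite patchE; case: ifPn => // /negP np; congr (_%:E).
  apply/esym/eqP; rewrite mulf_eq0; apply/orP; right.
  by apply/negPn/negP => /hS/Spos ?; apply: np; rewrite inE.
rewrite !ext//.
have ivD := vanishes_outside_integrable (cM _ _ cv cD) (vN _ v DN).
have igphi := vanishes_outside_integrable (cM _ _ cg cphi) (vN _ g phiN).
have I0 : (\int[@drdz R]_p (v p * D p + g p * phi p)%:E = 0)%E.
  apply: (@integral_partial_eq0 R N b (fun p => v p * phi p)).
  - move=> p; apply: (is_derive_eq (is_deriveM (dv p) (dphi p))).
    by rewrite /GRing.scale/= (mulrC (phi p)).
  - by move=> p; apply: cvgD; [exact: cM|exact: cM].
  - exact: vN.
  - move=> p; have [->|/DN//] := eqVneq (D p) 0.
    by rewrite mulr0 add0r; exact: vN.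
move: I0; under eq_integral do rewrite EFinD.
rewrite (integralD measurableT ivD igphi).
(* Both integrals are finite, so one of them can change sides in the extended reals. *)
have := integrable_fin_num measurableT ivD.
have := integrable_fin_num measurableT igphi.
rewrite /comp.
case: (integral _ _ _) => [y| |]// _; case: (integral _ _ _) => [x| |]// _.
by move=> [/eqP]; rewrite addr_eq0 => /eqP ->.
Qed.

(** * Bounds and tools shared by the energies and the capacity *)

(** Outside [0, 1] [step] is locally constant; on the compact [0, 1] its continuous derivative is
    bounded. *)
Lemma step_derive (R : realType) : exists S' : R -> R,
  [/\ smooth_expr S', forall x : R, is_derive x 1 (@step R) (S' x),
      forall x, x < 0 -> S' x = 0, forall x, 1 < x -> S' x = 0
    & exists2 C, 0 <= C & forall x, `|S' x| <= C].
Proof.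
have [S' sS' dS] := smooth_expr_derive (@smooth_expr_step R).
have S'lt0 x : x < 0 -> S' x = 0.
  move=> x0; have [_ <-] := dS x.
  have near0 : \near x, @step R x = cst 0 x.
    by apply: filterS (lt_nbhsl x0) => y y0; rewrite step_le0// ltW.
  by rewrite (near_eq_derive _ near0) derive_cst.
have S'gt1 x : 1 < x -> S' x = 0.
  move=> x1; have [_ <-] := dS x.
  have near1 : \near x, @step R x = cst 1 x.
    by apply: filterS (lt_nbhsr x1) => y y1; rewrite step_ge1// ltW.
  by rewrite (near_eq_derive _ near1) derive_cst.
exists S'; split => //.
have : compact (S' @` `[0, 1]).
  apply: continuous_compact; last exact: segment_compact.
  exact/continuous_subspaceT/smooth_expr_continuous.
move=> /compact_bounded[M [_ MP]]; exists (`|M| + 1) => [|x].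
  by rewrite addr_ge0.
have [x0|x0] := ltP x 0; first by rewrite S'lt0// normr0 addr_ge0.
have [x1|x1] := ltP 1 x; first by rewrite S'gt1// normr0 addr_ge0.
apply: MP; first by rewrite (le_lt_trans (ler_norm M))// ltrDl.
by exists x => //=; rewrite in_itv/= x0 x1.
Qed.

(** Comparison with [c] times the indicator of [Q]; since [Q] may exceed [D], monotonicity of the
    measure concludes. *)
Lemma integral_le_bound_support d (T : measurableType d) (R : realType)
    (mu : {measure set T -> \bar R}) (D Q : set T) (f : T -> R) (c : R) :
  measurable D -> measurable Q -> measurable_fun D f ->
  (forall x, D x -> 0 <= f x) -> 0 <= c ->
  (forall x, D x -> Q x -> f x <= c) -> (forall x, D x -> ~ Q x -> f x = 0) ->
  (\int[mu]_(x in D) (f x)%:E <= c%:E * mu Q)%E.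
Proof.
move=> mD mQ mf f0 c0 fc fQ.
apply: (@le_trans _ _ (\int[mu]_(x in D) (c%:E * (\1_Q x)%:E))%E).
  apply: ge0_le_integral => //.
  - exact/measurable_EFinP.
  - by apply/measurable_EFinP; apply: measurable_funM.
  - move=> x Dx; rewrite -EFinM lee_fin indicE; have [|] := boolP (x \in Q).
    + by rewrite inE mulr1 => Qx; exact: fc.
    + by rewrite notin_setE mulr0 => nQ; rewrite fQ.
rewrite ge0_integralZl_EFin//; last first.
  exact/measurable_EFinP/measurable_indic.
rewrite integral_indic// lee_wpmul2l//.
by apply: le_measure; rewrite ?inE//; exact: measurableI.
Qed.

Lemma continuous_separable (R : realType) (a b : R -> R) :
  smooth_expr a -> smooth_expr b -> continuous (fun p : R * R => a p.1 * b p.2).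
Proof.
move=> /smooth_expr_continuous ca /smooth_expr_continuous cb p.
apply: cvgM.
  by apply: (@continuous_comp _ _ _ fst a); [exact: cvg_fst|exact: ca].
by apply: (@continuous_comp _ _ _ snd b); [exact: cvg_snd|exact: cb].
Qed.

Lemma weak_derivative_separable (R : realType) (a b a' b' : R -> R) :
  smooth_expr a -> smooth_expr b -> smooth_expr a' -> smooth_expr b' ->
  (forall x : R, is_derive x 1 a (a' x)) ->
  (forall x : R, is_derive x 1 b (b' x)) ->
  weak_derivative (e_r R) (fun p => a p.1 * b p.2) (fun p => a' p.1 * b p.2) /\
  weak_derivative (e_z R) (fun p => a p.1 * b p.2) (fun p => a p.1 * b' p.2).
Proof.
move=> sa sb sa' sb' da db; split.
  apply: (@weak_derivative_C1 _ true); [exact: continuous_separable..|].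
  move=> [r z]; apply/is_derive_slice_r.
  apply: (is_derive_eq (is_deriveM (da r) (is_derive_cst (b z) r 1))).
  by rewrite scaler0 add0r /GRing.scale/= mulrC.
apply: (@weak_derivative_C1 _ false); [exact: continuous_separable..|].
move=> [r z]; apply/is_derive_slice_z.
apply: (is_derive_eq (is_deriveM (is_derive_cst (a r) z 1) (db z))).
by rewrite scaler0 addr0.
Qed.

(** A squeeze. With eps < 1, higher powers of eps can be weakened to the first, so a linear bound is
    enough. *)
Lemma cvge_at_right_linear (R : realType) (c : R) (F : R -> \bar R) :
  (forall eps, 0 < eps -> eps < 1 -> (0 <= F eps <= (c * eps)%:E)%E) ->
  F eps @[eps --> 0^'+] --> 0%E.
Proof.
move=> Fc; apply: (@squeeze_cvge _ _ _ _ (cst 0%E) _ (fun eps => (c * eps)%:E)).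
- near=> eps; apply: Fc; first by near: eps; exact: nbhs_right_gt.
  by near: eps; exact: nbhs_right_lt.
- exact: cvg_cst.
- apply: cvg_EFin; first exact: nearW.
  apply: cvg_at_right_filter; rewrite -[X in _ --> X](mulr0 c).
  exact: mulrl_continuous.
Unshelve. all: by end_near. Qed.

(** * Cutoffs in [r] and in [z] *)

(** One affine form covers the rescaling r/eps - 1 and the reflection -z + (M + 1). *)
Lemma smooth_expr_affine_comp (R : realType) (f f' : R -> R) (a b : R) :
  smooth_expr f -> smooth_expr f' -> (forall x : R, is_derive x 1 f (f' x)) ->
  [/\ smooth_expr (fun x => f (a * x + b)),
      smooth_expr (fun x => a * f' (a * x + b))
    & forall x : R,
        is_derive x 1 (fun x => f (a * x + b)) (a * f' (a * x + b))].
Proof.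
move=> sf sf' df.
have sl : smooth_expr (fun x : R => cst a x * id x + cst b x).
  apply: smooth_add; last exact: smooth_cst.
  by apply: smooth_mul; [exact: smooth_cst|exact: smooth_id].
split.
- exact: (smooth_comp sf sl).
- exact: (smooth_mul (smooth_cst a) (smooth_comp sf' sl)).
- move=> x.
  have dl : is_derive x 1 (fun x : R => a * x + b) a.
    have d := is_deriveD (is_deriveM (is_derive_cst a x 1) (is_derive_id x 1))
      (is_derive_cst b x 1).
    by apply: (is_derive_eq d); rewrite scaler0 !addr0 /GRing.scale/= mulr1.
  rewrite mulrC.
  exact: (@is_derive1_comp _ f (fun x => a * x + b) x _ _ (df _) dl).
Qed.

(** The argument maps [eps, 2 eps] onto [0, 1]; [+ (- 1)] matches the affine form [a * x + b]. *)
Definition radial_cutoff (R : realType) (eps r : R) : R :=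
  step (eps^-1 * r + (- 1)).

Lemma radial_cutoff_arg (R : realType) (eps r : R) : 0 < eps ->
  ((eps^-1 * r + (- 1) <= 0) = (r <= eps)) *
  ((1 <= eps^-1 * r + (- 1)) = (2 * eps <= r)) *
  ((1 < eps^-1 * r + (- 1)) = (2 * eps < r)).
Proof.
move=> e0; rewrite subr_le0 lerBrDr ltrBrDr.
by rewrite !(mulrC eps^-1) ler_pdivrMr// ler_pdivlMr// ltr_pdivlMr// mul1r.
Qed.

Lemma radial_cutoff0 (R : realType) (eps r : R) : 0 < eps -> r <= eps ->
  radial_cutoff eps r = 0.
Proof. by move=> e0 re; apply: step_le0; rewrite radial_cutoff_arg. Qed.

Lemma radial_cutoff1 (R : realType) (eps r : R) : 0 < eps -> 2 * eps <= r ->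
  radial_cutoff eps r = 1.
Proof. by move=> e0 re; apply: step_ge1; rewrite radial_cutoff_arg. Qed.

(** [C] is fixed before [eps]: the chain rule gives the factor 1/eps, and the slope of [step] bounds
    the rest. *)
Lemma radial_cutoff_derive (R : realType) : exists2 C : R, 0 < C &
  forall eps : R, 0 < eps -> exists chi' : R -> R,
  [/\ smooth_expr (radial_cutoff eps), smooth_expr chi',
      forall r : R, is_derive r 1 (radial_cutoff eps) (chi' r),
      forall r, 2 * eps < r -> chi' r = 0
    & forall r, `|chi' r| <= C / eps].
Proof.
have [S' [sS' dS _ S'gt1 [C C0 S'C]]] := step_derive R.
exists (C + 1) => [|eps e0]; first by rewrite ltr_wpDl.
have [s s' d] :=
  smooth_expr_affine_comp eps^-1 (- 1) (@smooth_expr_step R) sS' dS.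
exists (fun r => eps^-1 * S' (eps^-1 * r + (- 1))); split => // r.
- by move=> re; rewrite S'gt1 ?mulr0// radial_cutoff_arg.
- rewrite normrM gtr0_norm ?invr_gt0// mulrC ler_pM2r ?invr_gt0//.
  by rewrite (le_trans (S'C _))// lerDl.
Qed.

(** A step rising on [-(M+1), -M] times one falling on [M, M+1]. *)
Lemma vertical_cutoff (R : realType) (M : R) : exists (b b' : R -> R) (B : R),
  [/\ smooth_expr b, smooth_expr b', forall x : R, is_derive x 1 b (b' x),
      forall x, - M <= x <= M -> b x = 1
    & [/\ forall x, ~ - (M + 1) <= x <= M + 1 -> b x = 0,
        forall x, ~ - (M + 1) <= x <= M + 1 -> b' x = 0,
        forall x, `|b x| <= 1 & forall x, `|b' x| <= B]].
Proof.
have [S' [sS' dS S'lt0 _ [C C0 S'C]]] := step_derive R.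
have [s1 s1' d1] :=
  smooth_expr_affine_comp 1 (M + 1) (@smooth_expr_step R) sS' dS.
have [s2 s2' d2] :=
  smooth_expr_affine_comp (- 1) (M + 1) (@smooth_expr_step R) sS' dS.
exists (fun x => step (1 * x + (M + 1)) * step (- 1 * x + (M + 1))).
exists (fun x => step (1 * x + (M + 1)) * (- 1 * S' (- 1 * x + (M + 1))) +
                 step (- 1 * x + (M + 1)) * (1 * S' (1 * x + (M + 1)))).
(* Each of the two terms of the product rule is at most 1 times [C]. *)
exists (C + C); split.
- exact: smooth_mul.
- by apply: smooth_add; apply: smooth_mul.
- by move=> x; apply: is_deriveM.
- by move=> x xM; rewrite !step_ge1 ?mulr1//; lra.
(* The signs are strict because [S'lt0] speaks of negative arguments only. *)
have out x : ~ - (M + 1) <= x <= M + 1 ->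
    1 * x + (M + 1) < 0 \/ - 1 * x + (M + 1) < 0.
  move=> xM; have [x1|x1] := ltP (1 * x + (M + 1)) 0; first by left.
  by right; rewrite ltNge; apply/negP => x2; apply: xM; lra.
have step_norm (x : R) : `|step x| <= 1.
  by rewrite ger0_norm ?step_ge0 ?step_le1.
split.
- move=> x /out[] x0; first by rewrite step_le0 ?mul0r// ltW.
  by rewrite [X in _ * X]step_le0 ?mulr0// ltW.
- move=> x /out[] x0.
    by rewrite (S'lt0 _ x0) (step_le0 (ltW x0)) !mulr0 mul0r addr0.
  by rewrite (S'lt0 _ x0) (step_le0 (ltW x0)) !mulr0 mul0r addr0.
- by move=> x; rewrite normrM mulr_ile1.
- have bound (u v : R) : `|u| <= 1 -> `|v| <= C -> `|u * v| <= C.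
    by move=> u1 vC; rewrite normrM -[leRHS]mul1r ler_pM.
  move=> x; apply: le_trans (ler_normD _ _) _.
  by apply: lerD; apply: bound; rewrite // ?mulN1r ?normrN ?mul1r.
Qed.

(** * Energies of the radial cutoffs *)

(** The integrand is at most c^2 (2 eps)^3 on an interval of length 2 eps and zero beyond it. *)
Lemma radial_integral_le (R : realType) (eps c : R) (g : R -> R) :
  0 < eps -> smooth_expr g -> (forall r, `|g r| <= c) ->
  (forall r, 2 * eps < r -> g r = 0) ->
  (0 <= \int[@lebesgue_measure R]_(r in `[0%R, +oo[)
      (`|g r| ^+ 2 * r ^+ 3)%:E <= (16 * c ^+ 2 * eps ^+ 4)%:E)%E.
Proof.
move=> e0 sg gc g0; apply/andP; split.
  apply: integral_ge0 => r /=; rewrite in_itv/= andbT => r0; rewrite lee_fin.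
  by rewrite mulr_ge0 ?exprn_ge0.
have -> : (16 * c ^+ 2 * eps ^+ 4)%:E =
    ((8 * c ^+ 2 * eps ^+ 3)%:E * @lebesgue_measure R `[0%R, (2 * eps)%R])%E.
  rewrite lebesgue_measure_itv/= lte_fin mulr_gt0// -EFinB -EFinM subr0.
  by congr (_%:E); ring.
apply: integral_le_bound_support => //.
- apply: measurable_funTS; apply: measurable_funM; last exact: measurable_funX.
  under eq_fun do rewrite real_normK ?num_real// expr2.
  apply: continuous_measurable_fun; apply: smooth_expr_continuous.
  exact: smooth_mul.
- by move=> r /=; rewrite in_itv/= andbT => r0; rewrite mulr_ge0 ?exprn_ge0.
- by rewrite -mulrA mulr_ge0// mulr_ge0 ?sqr_ge0 ?exprn_ge0// ltW.
- move=> r _ /=; rewrite in_itv/= => /andP[r0 r2].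
  have -> : 8 * c ^+ 2 * eps ^+ 3 = c ^+ 2 * (2 * eps) ^+ 3 by ring.
  have c0 : 0 <= c by apply: le_trans (gc r).
  by rewrite ler_pM ?exprn_ge0// lerXn2r// nnegrE (le_trans r0).
- move=> r /=; rewrite !in_itv/= andbT => r0 nr.
  rewrite g0 ?normr0 ?expr0n ?mul0r//.
  by rewrite ltNge; apply/negP => r2; apply: nr; rewrite r0.
Qed.

Lemma smooth_onem (R : realType) (f : R -> R) : smooth_expr f ->
  smooth_expr (fun x => 1 - f x).
Proof.
move=> sf; rewrite (_ : (fun _ => _) = fun x => cst 1 x + cst (-1) x * f x).
  apply: smooth_add; first exact: smooth_cst.
  by apply: smooth_mul => //; exact: smooth_cst.
by apply/funext => x; rewrite /= mulN1r.
Qed.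

(** The inner integral does not depend on z, so the outer one multiplies it by the finite measure of
    [K]. The bound c/eps suits both the slope of the cutoff and 1 - chi, since 1 <= 1/eps for eps <
    1; the result is O(eps^2). *)
Lemma cvg_strip_integral (R : realType) (K : set R) (g : R -> R -> R) (c : R) :
  compact K ->
  (forall eps, 0 < eps -> eps < 1 ->
    [/\ smooth_expr (g eps), forall r, `|g eps r| <= c / eps
      & forall r, 2 * eps < r -> g eps r = 0]) ->
  (\int[@lebesgue_measure R]_(z in K)
    \int[@lebesgue_measure R]_(r in `[0%R, +oo[)
      (`|g eps r| ^+ 2 * r ^+ 3)%:E)%E @[eps --> 0^'+] --> 0%E.
Proof.
move=> cK gP.
have mK := compact_measurable cK.
have muK : @lebesgue_measure R K = (fine (@lebesgue_measure R K))%:E.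
  by rewrite fineK// ge0_fin_numE// compact_finite_measure.
have k0 : 0 <= fine (@lebesgue_measure R K) by rewrite fine_ge0.
move: (fine _) muK k0 => k muK k0.
apply: (@cvge_at_right_linear _ (16 * c ^+ 2 * k)) => eps e0 e1.
have [sg gc g0] := gP _ e0 e1.
have intK (I : \bar R) : (\int[@lebesgue_measure R]_(_ in K) I = I * k%:E)%E.
  by rewrite -muK; exact: integral_cst.
rewrite intK.
have /andP[I0 I1] := radial_integral_le e0 sg gc g0.
rewrite mule_ge0//=; apply: le_trans (lee_wpmul2r _ I1) _ => //.
rewrite -EFinM lee_fin.
have -> : 16 * (c / eps) ^+ 2 * eps ^+ 4 * k = 16 * c ^+ 2 * k * eps * eps.
  by field; rewrite gt_eqF.
rewrite ler_piMr ?(ltW e1)//.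
by rewrite mulr_ge0 ?(ltW e0)// mulr_ge0// mulr_ge0 ?sqr_ge0.
Qed.

(** * Capacity of the axis *)

Lemma measurable_closed_half_plane (R : realType) :
  measurable (closed_half_plane R).
Proof.
have := @measurable_fst _ _ R R measurableT `[0, +oo[ (measurable_itv _).
rewrite setTI; congr measurable.
by apply/seteqP; split=> p /=; rewrite in_itv/= andbT.
Qed.

Lemma compact_sub_itv (R : realType) (K : set R) : compact K ->
  exists2 M, 0 < M & forall x, K x -> - M < x < M.
Proof.
move=> /compact_bounded[N [_ KN]]; exists (`|N| + 2) => [|x Kx].
  by rewrite ltr_wpDl.
rewrite -ltr_norml; apply: (@le_lt_trans _ _ (`|N| + 1)); last by lra.
by apply: (KN _ _ x Kx); rewrite (le_lt_trans (ler_norm N))// ltrDl.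
Qed.

(** All three products vanish outside the box [0, 2 eps] x [-L, L] of area 4 L eps. On it the weight
    is at most 8 eps^3 and the squares sum to at most 1 + A^2 + B^2. *)
Lemma sq_norm_H1_mu5_separable_le (R : realType) (eps L A B : R)
    (a a' b b' : R -> R) :
  0 < eps -> 0 < L ->
  smooth_expr a -> smooth_expr a' -> smooth_expr b -> smooth_expr b' ->
  (forall r, 0 <= r -> `|a r| <= 1) -> (forall r, 0 <= r -> `|a' r| <= A) ->
  (forall z, `|b z| <= 1) -> (forall z, `|b' z| <= B) ->
  (forall r, 2 * eps < r -> a r = 0) -> (forall r, 2 * eps < r -> a' r = 0) ->
  (forall z, ~ - L <= z <= L -> b z = 0) ->
  (forall z, ~ - L <= z <= L -> b' z = 0) ->
  (sq_norm_H1_mu5 (fun p => a p.1 * b p.2)%R (fun p => a' p.1 * b p.2)%R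
      (fun p => a p.1 * b' p.2)%R <=
    (32 * L * (1 + A ^+ 2 + B ^+ 2) * eps ^+ 4)%:E)%E.
Proof.
move=> e0 L0 sa sa' sb sb' a1 aA b1 bB a0 a'0 b0 b'0.
have -> : (32 * L * (1 + A ^+ 2 + B ^+ 2) * eps ^+ 4)%:E =
    (((1 + A ^+ 2 + B ^+ 2) * (2 * eps) ^+ 3)%:E *
     @drdz R (`[0%R, (2 * eps)%R] `*` `[(- L)%R, L]))%E.
  rewrite drdz_setX// !lebesgue_measure_itv/= !lte_fin mulr_gt0//.
  rewrite (_ : - L < L); last by lra.
  by rewrite -!EFinB -!EFinM; congr (_%:E); ring.
have sqr_le (x y u v : R) :
    `|x| <= u -> `|y| <= v -> `|x * y| ^+ 2 <= (u * v) ^+ 2.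
  move=> xu yv; rewrite lerXn2r ?nnegrE// ?normrM ?ler_pM// mulr_ge0//.
    exact: le_trans xu.
  exact: le_trans yv.
rewrite /sq_norm_H1_mu5 /integral_mu5.
apply: integral_le_bound_support => //.
- exact: measurable_closed_half_plane.
- exact: measurableX.
- apply: measurable_funTS; apply: measurable_funM.
    do 2?[apply: measurable_funD]; apply: measurable_funX;
    apply: measurableT_comp => //; apply: continuous_measurable_prod;
    exact: continuous_separable.
  by apply: measurable_funX; exact: measurable_fst.
- by move=> p p0; rewrite mulr_ge0 ?exprn_ge0// !addr_ge0 ?sqr_ge0.
- by rewrite mulr_ge0 ?exprn_ge0 ?addr_ge0 ?sqr_ge0// mulr_ge0// ltW.
- move=> [r z] /= r0 [/=]; rewrite !in_itv/= => /andP[_ r2] _.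
  rewrite ler_pM ?exprn_ge0 ?addr_ge0 ?sqr_ge0//; last first.
    by rewrite lerXn2r// nnegrE (le_trans r0).
  apply: lerD; first apply: lerD.
  + rewrite -[leRHS](expr1n _ 2) -[X in _ <= X ^+ 2](mulr1 1).
    by apply: sqr_le; [exact: a1|exact: b1].
  + rewrite -[X in _ <= X ^+ 2](mulr1 A).
    by apply: sqr_le; [exact: aA|exact: b1].
  + rewrite -[X in _ <= X ^+ 2](mul1r B).
    by apply: sqr_le; [exact: a1|exact: bB].
- move=> [r z] /= r0 nQ.
  (* A point outside the box fails in r, which kills [a] and [a'], or in z, which kills [b] and
     [b']. *)
  have [r2|r2] := ltP (2 * eps) r.
    by rewrite a0// a'0// !mul0r normr0 expr0n !addr0 mul0r.
  have nz : ~ - L <= z <= L.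
    by move=> zL; apply: nQ; split; rewrite /= in_itv/= ?zL// r2 andbT.
  by rewrite b0// b'0// !mulr0 normr0 expr0n !addr0 mul0r.
Qed.

Lemma capacity_mu5_ge0 (R : realType) (A : set (R * R)) :
  (0 <= capacity_mu5 A)%E.
Proof.
apply: le_ereal_inf_tmp => _ [v [vr [vz [_ _ ->]]]].
apply: integral_ge0 => p p0.
by rewrite lee_fin mulr_ge0 ?exprn_ge0// !addr_ge0 ?sqr_ge0.
Qed.

Lemma capacity_mu5_axis_le (R : realType) (K : set R) : compact K ->
  exists2 c : R, 0 < c & forall eps, 0 < eps -> eps < 1 ->
    (capacity_mu5 ([set 0%R] `*` K) <= (c * eps)%:E)%E.
Proof.
move=> /compact_sub_itv[M M0 KM].
have [C C0 chiP] := radial_cutoff_derive R.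
have [b [b' [B [sb sb' db b1 [b0 b'0 ble1 b'leB]]]]] := vertical_cutoff M.
have L0 : 0 < M + 1 by lra.
exists (32 * (M + 1) * (1 + C ^+ 2 + B ^+ 2)) => [|eps e0 e1].
  by rewrite !mulr_gt0// -addrA ltr_pwDl// addr_ge0 ?sqr_ge0.
have [chi' [schi schi' dchi chi'0 chi'C]] := chiP _ e0.
pose a r := 1 - radial_cutoff eps r.
have sa : smooth_expr a by exact: smooth_onem.
(* The derivative -chi' is written as a product because [smooth_expr] has no constructor for
   opposites. *)
have sa' : smooth_expr (fun r => cst (-1) r * chi' r).
  by apply: smooth_mul => //; exact: smooth_cst.
have da (r : R) : is_derive r 1 a (cst (-1) r * chi' r).
  have -> : cst (-1) r * chi' r = 0 - chi' r by rewrite /= mulN1r sub0r.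
  exact: is_deriveB (is_derive_cst (1 : R) r (1 : R)) (dchi r).
have a1 r : `|a r| <= 1.
  by rewrite /a ger0_norm ?subr_ge0 ?step_le1// gerBl step_ge0.
have [wr wz] := weak_derivative_separable sa sb sa' sb' da db.
have := @sq_norm_H1_mu5_separable_le _ eps (M + 1) (C / eps) B a _ b b'
  e0 L0 sa sa' sb sb' (fun r _ => a1 r).
set E := sq_norm_H1_mu5 _ _ _ => Ele.
have {}Ele : (E <= (32 * (M + 1) * (1 + C ^+ 2 + B ^+ 2) * eps)%:E)%E.
  apply: le_trans (Ele _ _ _ _ _ _ _) _ => //.
  - by move=> r _; rewrite /= mulN1r normrN.
  - by move=> r r2; rewrite /a radial_cutoff1 ?subrr// ltW.
  - by move=> r r2; rewrite /= chi'0 ?mulr0.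
  rewrite lee_fin -!mulrA !ler_pM2l//.
  (* One factor eps is kept for the linear bound; the powers of eps left in the parenthesis are at
     most 1. *)
  have -> : (1 + (C / eps) ^+ 2 + B ^+ 2) * eps ^+ 4 =
    (eps ^+ 3 + C ^+ 2 * eps + B ^+ 2 * eps ^+ 3) * eps.
    by field; rewrite gt_eqF.
  rewrite ler_pM2r//.
  have e3 : eps ^+ 3 <= 1 by rewrite exprn_ile1// ltW.
  by rewrite !lerD// ler_piMr ?sqr_ge0// (ltW e1).
apply: (le_trans _ Ele); apply: ereal_inf_lbound.
exists (fun p => a p.1 * b p.2), (fun p => cst (-1) p.1 * chi' p.1 * b p.2),
  (fun p => a p.1 * b' p.2); split => //.
- split => //; last exact: le_lt_trans Ele (ltry _).
  by split; apply: measurable_funTS; apply: continuous_measurable_prod;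
    [exact: (continuous_separable sa sb)|exact: (continuous_separable sa' sb)
    |exact: (continuous_separable sa sb')].
(* On this strip r < eps and |z| < M, so chi = 0 and b = 1. It is open in the whole plane, negative
   r included. *)
- exists (fst @^-1` `]-oo, eps[ `&` snd @^-1` `]- M, M[); split.
  + apply: openI; apply: open_comp => [p _|]; try exact: interval_open.
      exact: cvg_fst.
    exact: cvg_snd.
  + by move=> [r z] [/= -> /KM zM]; rewrite /= !in_itv/= zM e0.
  + move=> [r z] [] []; rewrite /= !in_itv/= => re zM _.
    by rewrite /a radial_cutoff0// ?ltW// subr0 mul1r b1//; lra.
Qed.

Unset Implicit Arguments.

Theorem lemma3p1 (R : realType) (K : set R) (hK : compact K) :
  (exists chi : R -> R -> R,
    [/\ forall eps : R, 0 < eps ->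
          [/\ smooth_half_line (chi eps),
              forall r : R, 0 <= r -> r <= eps -> chi eps r = 0
            & forall r : R, 2 * eps <= r -> chi eps r = 1],
        (\int[@lebesgue_measure R]_(z in K)
          \int[@lebesgue_measure R]_(r in `[0%R, +oo[)
            (`|derive1 (chi eps) r| ^+ 2 * r ^+ 3)%:E)%E
          @[eps --> 0^'+] --> 0%E
      & (\int[@lebesgue_measure R]_(z in K)
          \int[@lebesgue_measure R]_(r in `[0%R, +oo[)
            (`|1 - chi eps r| ^+ 2 * r ^+ 3)%:E)%E
          @[eps --> 0^'+] --> 0%E])
  /\ capacity_mu5 ([set 0] `*` K) = 0%E.
Proof.
have [C C0 chiP] := radial_cutoff_derive R.
split; last first.
  have [c c0 cle] := capacity_mu5_axis_le hK.
  apply/eqP; rewrite eq_le capacity_mu5_ge0 andbT.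
  apply/lee_addgt0Pr => e e0; rewrite add0e.
  have ec : 0 < e + c by rewrite addr_gt0.
  (* This choice of eps is below 1 and satisfies c eps <= e. *)
  apply: le_trans (cle (e / (e + c)) _ _) _.
  - by rewrite divr_gt0.
  - by rewrite ltr_pdivrMr// mul1r ltrDl.
  - by rewrite lee_fin mulrCA ger_pMr// ler_pdivrMr// mul1r lerDr ltW.
exists (@radial_cutoff R); split.
- move=> eps e0; have [chi' [schi _ _ _ _]] := chiP _ e0.
  split; first by exists (radial_cutoff eps); [exact: smooth_expr_smooth|].
    by move=> r _; exact: radial_cutoff0.
  by move=> r; exact: radial_cutoff1.
- apply: (@cvg_strip_integral R K (fun eps => derive1 (radial_cutoff eps)) C).
    exact: hK.
  move=> eps e0 _; have [chi' [_ schi' dchi chi'0 chi'C]] := chiP _ e0.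
  rewrite (_ : derive1 _ = chi')//.
  by apply/funext => r; rewrite derive1E derive_val.
- apply: (@cvg_strip_integral R K (fun eps r => 1 - radial_cutoff eps r) 1 hK).
  move=> eps e0 e1; have [chi' [schi _ _ _ _]] := chiP _ e0; split => [|r|r r2].
  + exact: smooth_onem.
  + rewrite ger0_norm ?subr_ge0 ?step_le1// (@le_trans _ _ 1)//.
      by rewrite gerBl step_ge0.
    by rewrite mul1r invf_ge1// ltW.
  + by rewrite radial_cutoff1 ?subrr// ltW.
Qed.
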